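(* Let $I=[0,1)$. Given any topologically transitive $n$-IET $T:I\to I$, there exist an injective piecewise $\frac12$-affine contraction $f_T:I\to I$ of $n$ intervals and a continuous, surjective, nondecreasing map $h:I\to I$ such that $\theta_{f_T}(x)=\theta_T\big(h(x)\big)$ for every $x\in I$. In particular, if $T$ is an irreducible standard $n$-IET satisfying the i.d.o.c., then the language of each natural coding of $f_T$ equals the language of $T$.
   Context: $I=[0,1)$. A map $f:I\to I$ is a piecewise $\lambda$-affine contraction of $n$ intervals ($0<\lambda<1$) if there exist a partition of $I$ into non-degenerate intervals $I_1,\ldots,I_n$ (listed from left to right, fixed together with $f$), $b_1,\ldots,b_n\in\mathbb{R}$ and $\sigma_1,\ldots,\sigma_n\in\{-1,1\}$ such that $f(x)=\sigma_i\lambda x+b_i$ for every $x\in I_i$. A bijective map $T:I\to I$ is an $n$-interval exchange transformation ($n$-IET) if there exist a partition of $I$ into non-degenerate intervals $I_1,\ldots,I_n$ (listed from left to right, fixed together with $T$), $b_1,\ldots,b_n\in\mathbb{R}$ and $\sigma_1,\ldots,\sigma_n\in\{-1,1\}$ such that $T(x)=\sigma_i x+b_i$ for every $x\in I_i$. It is standard if every $I_i$ is left-closed and right-open and $T|_{I_i}$ is the translation $x\mapsto x+b_i$ for every $i$. It is irreducible if there is no $0<\delta<1$ with $T([0,\delta))\subset[0,\delta)$; equivalently, there is no $1\le j\le n-1$ with $T(\bigcup_{i=1}^jI_i)\subset\bigcup_{i=1}^jI_i$. It is topologically transitive if there is $x\in I$ whose orbit $\{x,T(x),T^2(x),\ldots\}$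 is dense in $I$. Writing $0=x_0<x_1<\cdots<x_n=1$ for the endpoints of the partition, $T$ satisfies the infinite distinct orbit condition (i.d.o.c.) if the orbits $\{x_i,T(x_i),T^2(x_i),\ldots\}$, $1\le i\le n-1$, are infinite and pairwise disjoint. (By Keane, an irreducible standard $n$-IET, $n\ge2$, satisfying the i.d.o.c. is minimal, i.e. all its orbits are dense, hence it is topologically transitive.) For $g$ a piecewise contraction or an IET with partition $I_1,\ldots,I_n$, the natural $g$-coding of $x\in I$ is the infinite word $\theta_g(x)=\theta_0\theta_1\ldots$ with $\theta_k=i$ whenever $g^k(x)\in I_i$ ($k\ge0$); the natural codings of $g$ are the words $\theta_g(x)$, $x\in I$. The language $\mathcal{L}(\theta)$ of an infinite word $\theta$ is the set of all finite words $\theta_m\theta_{m+1}\cdots\theta_{m+k-1}$ ($m\ge0$, $k\ge 0$) occurring in $\theta$, including the empty word. If $T$ is an irreducible standard $n$-IET satisfying the i.d.o.c., then $\mathcal{L}(\theta)$ is the same for all natural $T$-codings $\theta$, and this common set is called the language of $T$. *)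

(* Defs.v *)
From HB Require Import structures.
From mathcomp Require Import all_boot all_order all_algebra.
From mathcomp Require Import all_classical all_reals all_analysis.

Set Implicit Arguments.
Unset Strict Implicit.
Unset Printing Implicit Defensive.

Import Order.TTheory GRing.Theory Num.Theory.
Import numFieldNormedType.Exports.

Local Open Scope classical_set_scope.
Local Open Scope ring_scope.

Definition I01 (R : realType) : set R := `[0, 1[.
Arguments I01 {R}.

(* Maps of I01 are represented by functions R -> R whose values outside I01
   are irrelevant. *)

(* The pieces are indexed by 'I_n, i.e. from 0 to n-1. Pairwise disjointness is
   a consequence of cell_lt. *)
Record interval_partition (R : realType) (n : nat) := IntervalPartition {
  cell :> 'I_n -> set R;
  cell_itv : forall i, is_interval (cell i);
  cell_nondeg : forall i, exists x y, [/\ cell i x, cell i y & x < y];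
  cell_cover : \bigcup_i cell i = I01;
  cell_lt : forall i j : 'I_n, (i < j)%N ->
    forall x y, cell i x -> cell j y -> x < y }.

Section Maps.
Context {R : realType} {n : nat}.
Implicit Types (P : interval_partition R n) (f T g : R -> R).

Definition piecewise_affine (lam : R) P f : Prop :=
  exists (b sigma : 'I_n -> R),
    (forall i, sigma i = 1 \/ sigma i = -1) /\
    (forall i x, P i x -> f x = sigma i * lam * x + b i).

Definition piecewise_contraction (lam : R) P f : Prop :=
  [/\ 0 < lam < 1, set_fun I01 I01 f & piecewise_affine lam P f].

Definition iet P T : Prop := set_bij I01 I01 T /\ piecewise_affine 1 P T.

Definition standard P T : Prop :=
  (forall i, exists u v : R, P i = `[u, v[%classic) /\
  (exists b : 'I_n -> R, forall i x, P i x -> T x = x + b i).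

Definition irreducible T : Prop :=
  ~ exists delta : R, 0 < delta < 1 /\ T @` `[0, delta[ `<=` `[0, delta[.

Definition orbit T (x : R) : set R := range (fun k : nat => iter k T x).

Definition topologically_transitive T : Prop :=
  exists x, I01 x /\ I01 `<=` closure (orbit T x).

(* The left endpoint of a piece; those of the pieces of index i > 0 are the
   interior endpoints x_1, ..., x_(n-1) of the partition. *)
Definition left_endpoint P (i : 'I_n) : R := inf (P i).

Definition idoc P T : Prop :=
  (forall i : 'I_n, (0 < i)%N -> infinite_set (orbit T (left_endpoint P i))) /\
  (forall i j : 'I_n, (0 < i)%N -> (0 < j)%N -> i != j ->
     orbit T (left_endpoint P i) `&` orbit T (left_endpoint P j) = set0).

Lemma interval_partition_gt0 P : (0 < n)%N.
Proof.
have : I01 (0 : R) by rewrite /I01 /= in_itv /= lexx ltr01.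
by rewrite -(cell_cover P) => -[i _ _]; apply: leq_ltn_trans (ltn_ord i).
Qed.

(* The default value of xget is only used for x outside I01. *)
Definition letter P (x : R) : 'I_n :=
  xget (Ordinal (interval_partition_gt0 P)) [set i | P i x].

Lemma letterP P x i : P i x <-> I01 x /\ letter P x = i.
Proof.
have uniqP j k : P j x -> P k x -> j = k.
  move=> Pj Pk; apply/val_inj; case: (ltngtP j k) => // lt_jk.
    by have := cell_lt lt_jk Pj Pk; rewrite ltxx.
  by have := cell_lt lt_jk Pk Pj; rewrite ltxx.
have letP j : P j x -> P (letter P x) x.
  by move=> Pj; apply: (@xgetPex _ _ [set k | P k x]); exists j.
split=> [Pi|[]].
  by split; [rewrite -(cell_cover P); exists i | apply: uniqP (letP _ Pi) Pi].
by rewrite -(cell_cover P) => -[j _ /letP + <-].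
Qed.

Definition coding P g (x : R) : nat -> 'I_n := fun k => letter P (iter k g x).

Definition language (theta : nat -> 'I_n) : set (seq 'I_n) :=
  [set w | exists m k : nat, w = [seq theta j | j <- iota m k]].

(* All natural codings of g have the same language, and it is L. *)
Definition has_language P g (L : set (seq 'I_n)) : Prop :=
  forall x, I01 x -> language (coding P g x) = L.

End Maps.

(* f, with partition Q, is an injective piecewise 1/2-affine contraction whose
   natural codings are those of T along h. *)
Definition half_contraction_model (R : realType) (n : nat)
    (P : interval_partition R n) (T : R -> R)
    (Q : interval_partition R n) (f h : R -> R) : Prop :=
  [/\ piecewise_contraction 2^-1 Q f /\ set_inj I01 f,
      {within I01, continuous h},
      set_fun I01 I01 h /\ set_surj I01 I01 h,
      {in I01 &, {homo h : x y / x <= y}} &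
      forall x, I01 x -> coding Q f x = coding P T (h x)].

(* Main.v *)
(* Let d_i = inf T(P_i). When T has a dense orbit, the forward orbits of the d_i
   are together dense. Hence mu, the sum over k and i of the Dirac masses at
   T^k d_i with weights 1 / (n 2^(k+1)), is a probability of full support, and
   mu = nu + T_* mu / 2 with nu carried by the d_i. Opening each atom of mu into
   a gap of the same length and collapsing the gaps back gives h; as nu charges
   no point inside a T(P_i), lifting T through h scales lengths by 1/2 on each
   h^-1(P_i), and the lift is f.

   The second part needs Keane's theorem. If the orbit of x is not dense, let W
   be the set of the points having a neighbourhood that the orbit eventually
   avoids. The i.d.o.c. forbids left ends l > 0 of components of W: the forward
   or the backward orbit of l would consist of such ends and meet no
   discontinuity, so the lengths of the components there would be bounded below.
   Therefore W is an initial segment up to 0, with supremum r < 1, and T maps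
   [0, r) into itself, contradicting irreducibility. *)
Require Import Defs.
From mathcomp Require Import all_boot all_order all_algebra.
From mathcomp Require Import all_classical all_reals all_analysis.
From mathcomp Require Import zify lra.

Set Implicit Arguments.
Unset Strict Implicit.
Unset Printing Implicit Defensive.

Import Order.TTheory GRing.Theory Num.Theory.
Import numFieldNormedType.Exports.

Local Open Scope classical_set_scope.
Local Open Scope ring_scope.

(** * The blow-up measure *)

Section DyadicSum.
Context {R : realType}.
Implicit Types u v : nat -> R.

Definition dyadic_sum u : R := limn (series (fun k => u k / 2 ^+ k.+1)).

Lemma is_cvg_dyadic u : (forall k, 0 <= u k <= 1) ->
  cvgn (series (fun k => u k / 2 ^+ k.+1)).
Proof.
move=> u01; apply: (@series_le_cvg _ _ (geometric 2^-1 2^-1)).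
- by move=> k; have /andP[u0 _] := u01 k; rewrite divr_ge0 ?exprn_ge0.
- by move=> k; rewrite mulr_ge0 ?exprn_ge0 ?invr_ge0.
- move=> k; have /andP[_ u1] := u01 k.
  by rewrite /geometric/= -exprS exprVn ler_piMl ?invr_ge0 ?exprn_ge0.
- by apply: is_cvg_geometric_series; rewrite ger0_norm ?invr_ge0//; lra.
Qed.

Lemma dyadic_sumD u v : (forall k, 0 <= u k <= 1) -> (forall k, 0 <= v k <= 1) ->
  dyadic_sum (fun k => u k + v k) = dyadic_sum u + dyadic_sum v.
Proof.
move=> u01 v01; rewrite /dyadic_sum -lim_seriesD; [|exact: is_cvg_dyadic..].
by congr (limn (series _)); apply/funext => k /=; rewrite mulrDl.
Qed.

(** The origin of the ratio 1/2: dropping the first term and shifting the index doubles every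
    remaining weight. *)
Lemma dyadic_sum_rec u : (forall k, 0 <= u k <= 1) ->
  dyadic_sum u = (u 0%N + dyadic_sum (fun k => u k.+1)) / 2.
Proof.
move=> u01; apply/cvg_lim => //; rewrite -cvg_shiftS /=.
have -> : (fun k => series (fun k => u k / 2 ^+ k.+1) k.+1) =
    (fun k => (u 0%N + series (fun k => u k.+1 / 2 ^+ k.+1) k) / 2).
  apply/funext => k; rewrite /series /= big_nat_recl//= mulrDl expr1; congr (_ + _).
  rewrite mulr_suml; apply: eq_bigr => i _.
  by rewrite (exprSr _ i.+1) invfM mulrA.
apply: cvgM; last exact: cvg_cst.
apply: cvgD; first exact: cvg_cst.
by apply: is_cvg_dyadic => k; exact: u01.
Qed.

Lemma dyadic_sum_ge0 u : (forall k, 0 <= u k <= 1) -> 0 <= dyadic_sum u.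
Proof.
move=> u01; apply: limr_ge; first exact: is_cvg_dyadic.
apply: nearW => k; apply: sumr_ge0 => i _.
by have /andP[u0 _] := u01 i; rewrite divr_ge0 ?exprn_ge0.
Qed.

Lemma dyadic_sum1 : dyadic_sum (fun=> 1) = 1.
Proof.
have := @dyadic_sum_rec (fun=> 1); rewrite ler01 lexx => /(_ (fun=> isT)).
by lra.
Qed.

Lemma dyadic_sum_le1 u : (forall k, 0 <= u k <= 1) -> dyadic_sum u <= 1.
Proof.
move=> u01; have u01' k : 0 <= 1 - u k <= 1 by have := u01 k; lra.
rewrite -dyadic_sum1 -subr_ge0.
have -> : (fun=> 1) = (fun k => (1 - u k) + u k).
  by apply/funext => k; rewrite subrK.
by rewrite dyadic_sumD// addrK dyadic_sum_ge0.
Qed.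

Lemma dyadic_sum_tail u N : (forall k, 0 <= u k <= 1) ->
  (forall k, (k < N)%N -> u k = 0) -> dyadic_sum u <= 2^-1 ^+ N.
Proof.
elim: N u => [|N IH] u u01 u0; first by rewrite expr0 dyadic_sum_le1.
rewrite dyadic_sum_rec// u0// add0r exprSr ler_pM2r ?invr_gt0//.
by apply: IH => k; [exact: u01|move=> kN; exact: u0].
Qed.

Lemma dyadic_sum_gt0 u k : (forall k, 0 <= u k <= 1) -> 0 < u k -> 0 < dyadic_sum u.
Proof.
elim: k u => [|k IH] u u01 uk; rewrite dyadic_sum_rec//.
  by rewrite divr_gt0 ?ltr_wpDr ?dyadic_sum_ge0.
rewrite divr_gt0// ltr_wpDl//; first by have /andP[] := u01 0%N.
exact: (IH (fun k => u k.+1)).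
Qed.

End DyadicSum.

(** * Weighted orbit masses of finitely many points *)

Section Mass.
Context {R : realType} {n : nat}.
Variables (T : R -> R) (d : 'I_n -> R).
Hypotheses (n_gt0 : (0 < n)%N) (TI : set_fun I01 I01 T) (dI : forall i, I01 (d i)).
Implicit Types B C : set R.

(** Twice the part [nu] of [mu]: each [d i] counts for [1 / n], and the factor 1/2 appears in
    [mass_preimage]. *)
Definition hits B : R := n%:R^-1 * \sum_(i < n) \1_B (d i).

(** An explicit sum over orbit points, so it is defined on every set; finite additivity and
    [mass_small] replace measure theory. *)
Definition mass B : R :=
  dyadic_sum (fun k => n%:R^-1 * \sum_(i < n) \1_B (iter k T (d i))).

Let n0 : (0 : R) < n%:R. Proof. by rewrite ltr0n. Qed.

Let indic01 B x : 0 <= (\1_B x : R) <= 1.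
Proof. by rewrite indicE; case: (_ \in _); rewrite ?lexx ler01. Qed.

Let avg01 B (s : 'I_n -> R) :
  0 <= n%:R^-1 * (\sum_(i < n) \1_B (s i) : R) <= 1.
Proof.
have s0 : 0 <= \sum_(i < n) (\1_B (s i) : R).
  by apply: sumr_ge0 => i _; have /andP[] := indic01 B (s i).
rewrite mulr_ge0 ?invr_ge0 ?(ltW n0)//=.
rewrite mulrC ler_pdivrMr// mul1r -[leRHS]mulr1 mulr_natl -[n in leRHS]card_ord.
by rewrite -sumr_const ler_sum// => i _; have /andP[] := indic01 B (s i).
Qed.

Lemma iter_I01 k x : I01 x -> I01 (iter k T x).
Proof. by move=> Ix; elim: k => //= k IH; exact: TI. Qed.

Lemma eq_mass B C : (forall x, I01 x -> B x <-> C x) -> mass B = mass C.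
Proof.
move=> BC; rewrite /mass; congr dyadic_sum; apply/funext => k; congr (_ * _).
apply: eq_bigr => i _; rewrite !indicE; congr (nat_of_bool _)%:R.
by apply/idP/idP; rewrite !inE => /BC; apply; exact: iter_I01.
Qed.

Lemma massU B C : (forall x, B x -> C x -> False) ->
  mass (B `|` C) = mass B + mass C.
Proof.
move=> BC; rewrite /mass -dyadic_sumD//; congr dyadic_sum; apply/funext => k.
rewrite -mulrDr -big_split/=; congr (_ * _); apply: eq_bigr => i _.
rewrite !indicE in_setU.
case: (boolP (_ \in B)); case: (boolP (_ \in C)); rewrite ?inE => ? ? /=;
  rewrite ?addr0 ?add0r//.
by exfalso; apply: BC; eassumption.
Qed.

Lemma mass_ge0 B : 0 <= mass B.
Proof. by rewrite dyadic_sum_ge0. Qed.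

Lemma mass_setT : mass setT = 1.
Proof.
rewrite -[RHS]dyadic_sum1 /mass; congr dyadic_sum; apply/funext => k.
under eq_bigr do rewrite indicT.
by rewrite sumr_const card_ord mulVf// gt_eqF.
Qed.

Lemma mass_set0 : mass set0 = 0.
Proof.
by have := @massU set0 set0 (fun _ _ => id); rewrite setU0; lra.
Qed.

(** A set missing the first [N] points of every orbit has mass at most [2^-N]. This stands in for
    continuity of the measure along shrinking intervals. *)
Lemma mass_small e : 0 < e -> exists F : seq R,
  forall B, (forall x, x \in F -> ~ B x) -> mass B < e.
Proof.
move=> e0; have [N Ne] : exists N : nat, 2^-1 ^+ N < e.
  have /cvgrPdist_lt/(_ _ e0)[N _ /(_ N (leqnn N))] : 2^-1 ^+ k @[k --> \oo] --> (0 : R).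
    by apply: cvg_expr; rewrite ger0_norm; lra.
  by rewrite sub0r normrN ger0_norm ?exprn_ge0// => ?; exists N.
exists [seq iter k T (d i) | k <- iota 0 N, i <- enum 'I_n] => B BF.
apply: le_lt_trans Ne; apply: dyadic_sum_tail => // k kN.
rewrite big1 ?mulr0// => i _; rewrite indicE.
case: (boolP (_ \in B)) => //; rewrite inE => /BF; case.
by apply: allpairs_f; rewrite ?mem_iota ?mem_enum.
Qed.

Lemma mass_gt0 B k i : B (iter k T (d i)) -> 0 < mass B.
Proof.
move=> Bk; apply: (@dyadic_sum_gt0 _ _ k) => //.
rewrite mulr_gt0 ?invr_gt0// (bigD1 i)//= ltr_wpDr//.
  by apply: sumr_ge0 => j _; have /andP[] := indic01 B (iter k T (d j)).
by rewrite indicE mem_set.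
Qed.

(** The self-similarity [mu = nu + T_* mu / 2]: the terms with [k = 0] give the hits, and shifting
    the others pulls [B] back by [T]. *)
Lemma mass_preimage B : mass B = (hits B + mass (T @^-1` B)) / 2.
Proof. by rewrite {1}/mass dyadic_sum_rec. Qed.

End Mass.

(** * Density of the orbits of the infima of the images *)

Section DenseOrbits.
Context {R : realType}.
Implicit Types (T : R -> R) (F : seq R).

Lemma avoid_right F (u v : R) : u < v ->
  exists w, [/\ u < w, w <= v & forall z, z \in F -> ~ (u < z < w)].
Proof.
move=> uv; elim: F => [|z F [w [uw wv wF]]]; first by exists v.
have [uz|zu] := ltP u z; last first.
  exists w; split=> // y; rewrite inE => /orP[/eqP->|]; last exact: wF.
  by rewrite ltNge zu.
exists (Num.min z w); split; [by rewrite lt_min uz|by rewrite ge_min wv orbT|].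
move=> y; rewrite inE lt_min => /orP[/eqP->|yF]; first by rewrite ltxx andbF.
by move=> /and3P[uy _ yw]; apply: (wF y yF); rewrite uy.
Qed.

Lemma avoid_left F (u v : R) : u < v ->
  exists w, [/\ w < v, u <= w & forall z, z \in F -> ~ (w < z < v)].
Proof.
move=> uv; have [|w [vw wu wF]] := @avoid_right (map -%R F) (- v) (- u).
  by rewrite ltrN2.
exists (- w); split; [by rewrite ltrNl|by rewrite lerNr|] => z zF zw.
by apply: (wF (- z)); rewrite ?map_f// ltrN2 ltrNl andbC.
Qed.

Definition dense_orbit T (x : R) :=
  forall u v : R, 0 <= u -> u < v -> v <= 1 -> exists k, u < iter k T x < v.

Lemma closure_dense_orbit T x : I01 `<=` closure (Defs.orbit T x) <-> dense_orbit T x.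
Proof.
split=> [cl u v u0 uv v1|dT y /=].
  have : I01 ((u + v) / 2) by rewrite /I01/= in_itv/=; lra.
  move=> /cl /(_ `]u, v[%classic)[].
    by apply: open_nbhs_nbhs; split; [exact: interval_open|rewrite /= in_itv/=; lra].
  by move=> _ [[k _ <-]] /=; rewrite in_itv/= => ?; exists k.
rewrite /I01/= in_itv/= => y01 B /nbhs_ballP[e /= e0 yeB].
have [|||k ku] := dT y (Num.min (y + e) 1).
- by lra.
- by rewrite lt_min; lra.
- by rewrite ge_min lexx orbT.
exists (iter k T x); split; first by exists k.
apply: yeB; rewrite /ball/= ltr_distlC; move: ku; rewrite lt_min; lra.
Qed.

(** Eventual periodicity leaves finitely many orbit points, which miss some interval just to the
    right of 0. *)
Lemma periodic_not_dense T x a p : (0 < p)%N ->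
  iter p T (iter a T x) = iter a T x -> ~ dense_orbit T x.
Proof.
move=> p0 xp dx; pose F := [seq iter j T x | j <- iota 0 (a + p)].
have inF k : iter k T x \in F.
  elim/ltn_ind: k => k IH; have [kap|apk] := ltnP k (a + p).
    by apply: map_f; rewrite mem_iota.
  suff -> : iter k T x = iter (k - p) T x by apply: IH; lia.
  rewrite (_ : k = (k - (a + p)) + (p + a))%N; last by lia.
  by rewrite iterD iterD xp -iterD; congr iter; lia.
have [w [w0 w1 wF]] := @avoid_right F 0 1 ltr01.
by have [k] := dx 0 w (lexx _) w0 w1; exact: wF.
Qed.

End DenseOrbits.

(** * Bijections that are piecewise affine with slopes 1 and -1 *)

Section AffineExchange.
Context {R : realType} {n : nat}.
Variables (P : interval_partition R n) (T : R -> R) (s b : 'I_n -> R).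
Hypotheses (Tbij : set_bij I01 I01 T).
Hypotheses (s1 : forall i, s i = 1 \/ s i = -1).
Hypotheses (Tb : forall i x, P i x -> T x = s i * x + b i).
Implicit Types (A B : set R) (x y z : R) (i j : 'I_n).

Lemma bij_I01 x : I01 x -> I01 (T x).
Proof. by case: Tbij => [TI _ _]; exact: TI. Qed.

Lemma bij_inj x y : I01 x -> I01 y -> T x = T y -> x = y.
Proof. by case: Tbij => [_ Ti _] Ix Iy; apply: Ti; rewrite inE. Qed.

Lemma bij_surj y : I01 y -> exists2 x, I01 x & T x = y.
Proof. by case: Tbij => [_ _ Ts] /Ts[x Ix <-]; exists x. Qed.

Lemma bij_iter_surj m y : I01 y -> exists2 x, I01 x & iter m T x = y.
Proof.
elim: m y => [|m IH] y Iy; first by exists y.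
have [z Iz <-] := bij_surj Iy; have [x Ix <-] := IH _ Iz.
by exists x.
Qed.

Lemma cell_I01 i x : P i x -> I01 x.
Proof. by move=> /letterP[]. Qed.

Lemma cell_inj i j x : P i x -> P j x -> i = j.
Proof. by move=> /letterP[_ <-] /letterP[_ <-]. Qed.

Lemma cell_letter x : I01 x -> P (letter P x) x.
Proof. by move=> Ix; apply/letterP. Qed.

Lemma I01P x : I01 x <-> 0 <= x < 1.
Proof. by rewrite /I01/= in_itv/=. Qed.

Lemma image_cell_itv i x y z : P i x -> P i y -> T x <= z <= T y ->
  exists2 w, P i w & T w = z.
Proof.
move=> Px Py; rewrite (Tb Px) (Tb Py) => xzy.
exists (s i * (z - b i)); last first.
  rewrite (@Tb i); first by case: (s1 i) => ->; lra.
  apply: (@cell_itv _ _ P i (Num.min x y) (Num.max x y)).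
  - by rewrite /Num.min; case: ifP.
  - by rewrite /Num.max; case: ifP.
  - by case: (s1 i) xzy => ->; rewrite ge_min le_max; lra.
apply: (@cell_itv _ _ P i (Num.min x y) (Num.max x y)).
- by rewrite /Num.min; case: ifP.
- by rewrite /Num.max; case: ifP.
- by case: (s1 i) xzy => ->; rewrite ge_min le_max; lra.
Qed.

Definition image_inf i : R := inf (T @` P i).
Local Notation d := image_inf.

Let image_lb i : lbound (T @` P i) 0.
Proof. by move=> _ [x /cell_I01/bij_I01 /I01P/andP[? _] <-]. Qed.

Lemma image_inf_le i x : P i x -> d i <= T x.
Proof.
move=> Px; apply: ge_inf; last by exists x.
by exists 0; exact: image_lb.
Qed.

Lemma image_inf_lt i z : d i < z -> exists2 x, P i x & T x < z.
Proof.
move=> dz; have [x [y [Px _ _]]] := cell_nondeg P i.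
have [||_ [w Pw <-] wz] := @inf_adherent _ (T @` P i) (z - d i).
- by rewrite subr_gt0.
- by split; [exists (T x); exists x|exists 0; exact: image_lb].
by exists w => //; move: wz; rewrite -/(d i); lra.
Qed.

Lemma image_inf_I01 i : I01 (d i).
Proof.
have [x [y [Px _ _]]] := cell_nondeg P i.
apply/I01P/andP; split.
  by apply: lb_le_inf; [exists (T x); exists x|exact: image_lb].
apply: le_lt_trans (image_inf_le Px) _.
by have /I01P/andP[] := bij_I01 (cell_I01 Px).
Qed.

(** Let [T x <= T y]. Either [d j] lies between them, hence in [B], or [T x] lies in the interval
    [T(P j)], and injectivity puts [x] in [P j]. *)
Lemma avoiding_interval_cell B x y i j : is_interval B ->
  (forall l, ~ B (d l)) -> P i x -> P j y -> B (T x) -> B (T y) -> i = j.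
Proof.
move=> iB dB; wlog xy : x y i j / T x <= T y => [H|] Px Py BTx BTy.
  have [xy|/ltW yx] := leP (T x) (T y); first exact: (H x y).
  by apply/esym/(H y x).
have [xd|dx] := leP (T x) (d j).
  case: (dB j); apply: (iB _ _ BTx BTy).
  by rewrite xd image_inf_le.
have [w Pw wx] := image_inf_lt dx.
have [|z Pz zx] := @image_cell_itv j w y (T x) Pw Py.
  by rewrite xy ltW.
apply: (cell_inj Px); rewrite (_ : x = z)//.
exact: bij_inj (cell_I01 Px) (cell_I01 Pz) (esym zx).
Qed.

Definition orbit_avoiding B := [/\ is_interval B, B `<=` I01 &
  forall k i, ~ B (iter k T (d i))].

(** By [avoiding_interval_cell], the preimage under [T] of an interval without any [d i] lies in a
    single piece, where [T] is affine. Hence it is again an interval, and the affine form passes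
    from [m] to [m.+1]. *)
Lemma orbit_avoiding_preimage m B : orbit_avoiding B ->
  orbit_avoiding [set x | I01 x /\ B (iter m T x)] /\
  exists t c : R, (t = 1 \/ t = -1) /\
    forall x, I01 x -> B (iter m T x) -> iter m T x = t * x + c.
Proof.
move=> avB; elim: m => [|m [[iB BI dB] [t [c [t1 tc]]]]].
  split; last by exists 1, 0; split=> [|x _ _]; [left|rewrite mul1r addr0].
  case: avB => iB BI dB; split.
  - by move=> x y [_ Bx] [_ By] z xzy; have Bz := iB x y Bx By z xzy; split; [exact: BI|].
  - by move=> x [].
  - by move=> k i [_ /dB].
have d0 l : ~ (I01 (d l) /\ B (iter m T (d l))) by move/(dB 0%N).
have cellE x y i j : P i x -> P j y ->
    B (iter m.+1 T x) -> B (iter m.+1 T y) -> i = j.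
  rewrite !iterSr => Px Py Bx By; apply: (avoiding_interval_cell iB d0 Px Py) => /=.
    by split=> //; exact/bij_I01/(cell_I01 Px).
  by split=> //; exact/bij_I01/(cell_I01 Py).
split.
  split.
  - move=> x y [Ix Bx] [Iy By] z xzy.
    have Px := cell_letter Ix; have Py := cell_letter Iy.
    have ij := cellE _ _ _ _ Px Py Bx By.
    rewrite -ij in Py; set i := letter P x in Px Py.
    have Pz := cell_itv Px Py xzy; split; first exact: cell_I01 Pz.
    move: Bx By; rewrite !iterSr => Bx By.
    have TB w : P i w -> B (iter m T (T w)) -> I01 (T w) /\ B (iter m T (T w)).
      by move=> /cell_I01/bij_I01.
    have [] : I01 (T z) /\ B (iter m T (T z)) => //.
    have [sx|sx] := s1 i.
      apply: (iB (T x) (T y)); [exact: TB|exact: TB|].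
      by rewrite (Tb Px) (Tb Py) (Tb Pz) sx; lra.
    apply: (iB (T y) (T x)); [exact: TB|exact: TB|].
    by rewrite (Tb Px) (Tb Py) (Tb Pz) sx; lra.
  - by move=> x [].
  - move=> k i [Ix]; rewrite iterSr -iterS => Bx; apply: (dB k.+1 i).
    by split=> //; rewrite iterS; exact: bij_I01.
(* Any point of the preimage reveals the piece containing all of it; an empty preimage allows
   arbitrary coefficients. *)
have [[x [Ix Bx]]|no] := pselect (exists x, I01 x /\ B (iter m.+1 T x)); last first.
  by exists 1, 0; split=> [|x Ix Bx]; [left|case: no; exists x].
have Px := cell_letter Ix; set i := letter P x in Px.
exists (t * s i), (t * b i + c); split.
  by case: t1 => ->; case: (s1 i) => ->; rewrite ?mulN1r ?opprK ?mul1r; auto.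
move=> y Iy By; have Py := cell_letter Iy.
have ij := cellE _ _ _ _ Px Py Bx By; rewrite -ij in Py.
rewrite iterSr tc; [|exact: bij_I01|by rewrite -iterSr].
by rewrite (Tb Py); lra.
Qed.

(** The translation would push [A] below its infimum if [c > 0] and above its supremum if
    [c < 0]. *)
Lemma shifted_subset_eq0 A c : A !=set0 -> A `<=` I01 ->
  (forall y, A y -> A (y - c)) -> c = 0.
Proof.
move=> A0 AI Ac; have lA : has_inf A.
  by split=> //; exists 0 => y /AI/I01P/andP[].
have uA : has_sup A.
  by split=> //; exists 1 => y /AI/I01P/andP[_ /ltW].
apply/eqP; rewrite eq_le; apply/andP; split; rewrite leNgt; apply/negP => c0.
  have [y Ay yc] := inf_adherent c0 lA.
  by have := ge_inf lA.2 (Ac _ Ay); lra.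
have [|y Ay yc] := @sup_adherent _ _ (- c) _ uA; first by lra.
by have := ub_le_sup uA.2 (Ac _ Ay); lra.
Qed.

(* Otherwise let A be the largest interval containing ]u, v[ that avoids these
   orbits, and m the time between two visits of the dense orbit to ]u, v[. Then
   T^(-m) A is an interval avoiding the orbits and meeting A, hence contained in
   A; T^m is affine on it with slope 1 or -1, so T^m or T^(2m) is the identity
   there and the dense orbit is periodic. *)
Lemma image_inf_orbits_dense x0 (u v : R) : I01 x0 -> dense_orbit T x0 ->
  0 <= u -> u < v -> v <= 1 -> exists k i, u < iter k T (d i) < v.
Proof.
move=> Ix0 dx u0 uv v1; apply: contrapT => no.
pose J : set R := [set z | u < z < v].
have avJ : orbit_avoiding J.
  split.
  - by move=> x y /andP[? ?] /andP[? ?] z xzy; rewrite /J/=; lra.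
  - by move=> x /andP[? ?]; apply/I01P; lra.
  - by move=> k i kJ; apply: no; exists k, i.
have Jc : J ((u + v) / 2) by rewrite /J/=; lra.
have avU B C w : orbit_avoiding B -> orbit_avoiding C -> B w -> C w ->
    orbit_avoiding (B `|` C).
  move=> [iB BI dB] [iC CI dC] Bw Cw; split.
  - have main D E x y z : is_interval D -> is_interval E -> D w -> E w ->
        D x -> E y -> x <= z <= y -> (D `|` E) z.
      move=> iD iE Dw Ew Dx Ey xzy; have [zw|wz] := leP z w.
        by left; apply: (iD x w) => //; lra.
      by right; apply: (iE w y) => //; lra.
    move=> x y [Bx|Cx] [By|Cy] z xzy.
    + by left; apply: (iB x y).
    + exact: (main B C x y).
    + by rewrite setUC; exact: (main C B x y).
    + by right; apply: (iC x y).
  - by move=> x [/BI|/CI].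
  - by move=> k i [/dB|/dC].
pose A : set R := [set y | exists B, [/\ orbit_avoiding B, J `<=` B & B y]].
have JA : J `<=` A by move=> y Jy; exists J; split.
have avA : orbit_avoiding A.
  split.
  - move=> x y [B [avB JB Bx]] [C [avC JC Cy]] z xzy.
    exists (B `|` C); split; first by apply: avU (JB _ Jc) (JC _ Jc).
      by move=> t /JB; left.
    have [iU _ _] := avU B C _ avB avC (JB _ Jc) (JC _ Jc).
    by apply: (iU x y) => //; [left|right].
  - by move=> x [B [[_ BI _] _ /BI]].
  - by move=> k i [B [[_ _ dB] _ /dB]].
have maxA B w : orbit_avoiding B -> A w -> B w -> B `<=` A.
  move=> avB Aw Bw y By; exists (A `|` B); split; last by right.
    exact: avU Aw Bw.
  by move=> t /JA; left.
have [iA AI _] := avA.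
have [a xaJ] := dx u v u0 uv v1.
(* []u, w[] misses the first [a + 1] orbit points, so a visit to it happens at a time [e > a] and at
   a point other than [xa]. *)
have [w [uw wv wF]] := @avoid_right _ [seq iter k T x0 | k <- iota 0 a.+1] u v uv.
have [e xeJ] := dx u w u0 uw (le_trans wv v1).
have inF k : (k <= a)%N -> iter k T x0 \in [seq iter k T x0 | k <- iota 0 a.+1].
  by move=> ka; apply: (map_f (fun k => iter k T x0)); rewrite mem_iota.
have ae : (a < e)%N by rewrite ltnNge; apply/negP => /inF/wF; exact.
have xea : iter e T x0 <> iter a T x0.
  by move=> E; apply: (wF _ (inF _ (leqnn a))); rewrite -E.
pose m := (e - a)%N; set xa := iter a T x0 in xaJ xea *.
have xeE : iter e T x0 = iter m T xa.
  by rewrite /xa -iterD /m subnK// ltnW.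
set xe := iter e T x0 in xeJ xea xeE *.
have Axa : A xa by apply: JA.
have Axe : A xe by apply: JA; rewrite /J/=; lra.
have [avm [t [c [t1 tc]]]] := @orbit_avoiding_preimage m A avA.
have subA := maxA _ xa avm Axa (conj (AI _ Axa) (eq_ind _ A Axe _ xeE)).
have surjA y : A y -> exists x, [/\ I01 x, A (iter m T x) & iter m T x = y].
  move=> Ay; have [x Ix xy] := bij_iter_surj m (AI _ Ay).
  by exists x; rewrite xy.
have xec : xe = t * xa + c.
  by rewrite xeE tc//; [exact: AI|rewrite -xeE].
case: t1 => tE; subst t.
  (* In slope 1, [A - c] is contained in [A], so [c = 0] and [xe = xa], which was excluded. *)
  have c0 : c = 0.
    apply: (@shifted_subset_eq0 A) => //; first by exists xa.
    move=> y /surjA[x [Ix Ax xy]].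
    rewrite -xy tc// (_ : _ - c = x); last by lra.
    exact: subA.
  by apply: xea; rewrite xec c0; lra.
(* In slope -1, [T^m] acts on [A] as the reflection [y -> c - y], so [T^(2m)] fixes [xa]. *)
have refl y : A y -> A (c - y).
  move=> /surjA[x [Ix Ax xy]].
  by rewrite -xy tc// (_ : c - _ = x); [exact: subA|lra].
have mA y : A y -> iter m T y = c - y.
  move=> Ay; have /surjA[x [Ix Ax xy]] := refl y Ay.
  suff -> : y = x by rewrite tc//; lra.
  by move: xy; rewrite tc//; lra.
apply: (@periodic_not_dense _ T x0 a (m + m)) => //; first by rewrite /m; lia.
by rewrite -/xa iterD -xeE mA// xec; lra.
Qed.

End AffineExchange.

(** * The contraction *)

Section BlowUp.
Context {R : realType} {n : nat}.
Variables (P : interval_partition R n) (T : R -> R) (s b : 'I_n -> R).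
Hypotheses (Tbij : set_bij I01 I01 T).
Hypotheses (s1 : forall i, s i = 1 \/ s i = -1).
Hypotheses (Tb : forall i x, P i x -> T x = s i * x + b i).
Local Notation d := (image_inf P T).
Hypothesis d_dense : forall u v : R, 0 <= u -> u < v -> v <= 1 ->
  exists k i, u < iter k T (d i) < v.
Implicit Types (x y z : R) (i j : 'I_n).

Local Notation mu := (mass T d).

Let n_gt0 := interval_partition_gt0 P.
Let TI : set_fun I01 I01 T. Proof. by case: Tbij. Qed.
Let dI := image_inf_I01 P Tbij.

(** * Left and right distribution functions of [mu] *)

Definition mass_lt y := mu [set z | z < y].
Definition mass_le y := mu [set z | z <= y].
Local Notation M := mass_lt.
Local Notation Mp := mass_le.

Lemma mass_split (B C D : set R) : (forall x, B x -> C x -> False) ->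
  (forall x, D x <-> B x \/ C x) -> mu D = mu B + mu C.
Proof. by move=> BC DBC; rewrite -massU//; apply: eq_mass. Qed.

Lemma mass_lt_co y z : y <= z -> M z = M y + mu [set t | y <= t < z].
Proof.
move=> yz; apply: mass_split => [x /=|x /=]; first by lra.
by split=> [xz|]; [have [|] := ltP x y; [left|right]|move=> []; lra].
Qed.

Lemma mass_lt_oo y z : y < z -> M z = Mp y + mu [set t | y < t < z].
Proof.
move=> yz; apply: mass_split => [x /=|x /=]; first by lra.
by split=> [xz|]; [have [|] := leP x y; [left|right]|move=> []; lra].
Qed.

Lemma mass_le_oc y z : y <= z -> Mp z = Mp y + mu [set t | y < t <= z].
Proof.
move=> yz; apply: mass_split => [x /=|x /=]; first by lra.
by split=> [xz|]; [have [|] := leP x y; [left|right]|move=> []; lra].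
Qed.

Lemma mass_le_lt y : Mp y = M y + mu [set y].
Proof.
apply: mass_split => [x /= xy xE|x /=]; first by rewrite xE ltxx in xy.
rewrite le_eqVlt; split=> [/orP[/eqP|]|[|]];
  [by right|by left|by move=> ->; rewrite orbT|].
by move=> ->; rewrite eqxx.
Qed.

Let mu_ge0 B : 0 <= mu B. Proof. exact: mass_ge0. Qed.

Lemma mass_lt_mono y z : y <= z -> M y <= M z.
Proof. by move=> /mass_lt_co ->; rewrite lerDl. Qed.

Lemma mass_lt_le y : M y <= Mp y.
Proof. by rewrite mass_le_lt lerDl. Qed.

(** Full support: []y, z[] contains some [iter k T (d i)], whose mass is positive. *)
Lemma mass_le_strict y z : 0 <= y -> y < z -> z <= 1 -> Mp y < M z.
Proof.
move=> y0 yz z1; rewrite (mass_lt_oo yz) ltrDl.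
by have [k [i ki]] := d_dense y0 yz z1; apply: (@mass_gt0 _ _ _ _ n_gt0 _ k i).
Qed.

Lemma mass_lt0 : M 0 = 0.
Proof.
rewrite -[RHS](mass_set0 T d n_gt0); apply: eq_mass => // x /I01P/andP[x0 _].
by split=> //=; rewrite ltNge x0.
Qed.

Lemma mass_lt1 : M 1 = 1.
Proof.
rewrite -[RHS](mass_setT T d n_gt0); apply: eq_mass => // x /I01P/andP[_ x1].
by split.
Qed.

Lemma mass_le_lt1 y : I01 y -> Mp y < 1.
Proof. by move=> /I01P/andP[y0 y1]; rewrite -mass_lt1 mass_le_strict. Qed.

(* The fiber of y is the segment [M y, Mp y], which is a single point unless y
   is an atom. *)
Definition collapse x : R := sup [set y | I01 y /\ M y <= x].
Local Notation h := collapse.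

(** [M] is continuous from the left and [Mp] from the right, each by [mass_small] on a short
    interval free of the finitely many heavy points. *)
Lemma collapseP x : I01 x -> I01 (h x) /\ M (h x) <= x <= Mp (h x).
Proof.
move=> /I01P/andP[x0 x1]; set S := [set y | I01 y /\ M y <= x].
have S0 : S 0 by split; [apply/I01P; rewrite lexx ltr01|rewrite mass_lt0].
have supS : has_sup S.
  by split; [exists 0|exists 1 => y [/I01P/andP[_ /ltW]]].
have h0 : 0 <= h x by exact: ub_le_sup supS.2 _ S0.
have h1 : h x < 1.
  (* Near 1 the mass still to come is below [1 - x], so [M] exceeds [x] there and the supremum stays
     below 1. *)
  have x1' : 0 < 1 - x by lra.
  have [F FB] := @mass_small _ _ T d n_gt0 _ x1'.
  have [w [w1 w0 wF]] := @avoid_left _ F 0 1 ltr01.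
  have y1 : (w + 1) / 2 <= 1 by lra.
  have := mass_lt_co y1; rewrite mass_lt1.
  have := FB [set t | (w + 1) / 2 <= t < 1].
  move=> /(_ _)/wrap[z /wF zw /= zw'|]; first by apply: zw; lra.
  move=> small Ey; apply: (@le_lt_trans _ _ ((w + 1) / 2)); last by lra.
  apply: ge_sup; first by exists 0.
  move=> y [_ yx]; rewrite leNgt; apply/negP => wy.
  by have := mass_lt_mono (ltW wy); lra.
have Ih : I01 (h x) by apply/I01P; rewrite h0 h1.
split=> //; apply/andP; split; rewrite leNgt; apply/negP => lt_x.
  have x1' : 0 < M (h x) - x by lra.
  have [F FB] := @mass_small _ _ T d n_gt0 _ x1'.
  have h0' : 0 < h x.
    rewrite lt_neqAle h0 andbT; apply/eqP => hx0.
    by move: lt_x; rewrite -hx0 mass_lt0; lra.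
  have [w [w1 w0 wF]] := @avoid_left _ F 0 (h x) h0'.
  have hw : 0 < h x - w by lra.
  have [y Sy yw] := sup_adherent hw supS.
  have yh : y <= h x by exact: ub_le_sup supS.2 _ Sy.
  have := mass_lt_co yh; have [_ yx] := Sy.
  have := FB [set t | y <= t < h x].
  move=> /(_ _)/wrap[z /wF zw /= zw'|]; last by lra.
  by apply: zw; move: yw; rewrite -/(h x); lra.
(* By right continuity, a point just to the right of [h x] would still belong to [S]. *)
have x1' : 0 < x - Mp (h x) by lra.
have [F FB] := @mass_small _ _ T d n_gt0 _ x1'.
have [w [w1 w0 wF]] := @avoid_right _ F (h x) 1 h1.
have hy : h x < (h x + w) / 2 by lra.
have := mass_lt_oo hy.
have := FB [set t | h x < t < (h x + w) / 2].
move=> /(_ _)/wrap[z /wF zw /= zw'|small Ey]; first by apply: zw; lra.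
suff : (h x + w) / 2 <= h x by lra.
by apply: (ub_le_sup supS.2); split; [apply/I01P; lra|lra].
Qed.

(** By full support the segments [[M y, Mp y]] are pairwise disjoint and ordered as the points
    [y]. *)
Lemma collapse_unique x y : I01 x -> I01 y -> M y <= x <= Mp y -> h x = y.
Proof.
move=> Ix Iy xy; have [Ih hx] := collapseP Ix.
have main u v t : I01 u -> I01 v -> t <= Mp u -> M v <= t -> v <= u.
  move=> /I01P/andP[u0 u1] /I01P/andP[v0 v1] tu vt; rewrite leNgt.
  by apply/negP => uv; have := mass_le_strict u0 uv (ltW v1); lra.
by apply/eqP; rewrite eq_le (main y (h x) x) ?(main (h x) y x)//; lra.
Qed.

Lemma collapse_mono : {in I01 &, {homo h : x y / x <= y}}.
Proof.
move=> x y; rewrite !inE => Ix Iy xy; rewrite leNgt; apply/negP => yx.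
have [/I01P/andP[hx0 hx1] hx] := collapseP Ix.
have [/I01P/andP[hy0 hy1] hy] := collapseP Iy.
by have := mass_le_strict hy0 yx (ltW hx1); lra.
Qed.

Lemma collapse_surj y : I01 y -> I01 (M y) /\ h (M y) = y.
Proof.
move=> Iy; have := mass_lt_le y; have := mass_le_lt1 Iy.
have := mass_lt_mono (proj1 (andP (proj1 (I01P y) Iy))); rewrite mass_lt0 => M0 Mp1 MMp.
have IM : I01 (M y) by apply/I01P; lra.
by split=> //; apply: collapse_unique => //; rewrite lexx.
Qed.

(** For [y > h x], full support gives [x <= Mp (h x) < M y], and every [t < M y] has [h t < y]. The
    left side is symmetric, with [Mp y] for [y < h x]. *)
Lemma collapse_continuous : {within I01, continuous h}.
Proof.
apply/subspace_continuousP => x Ix; apply/cvgrPdist_lt => e e0.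
have [/I01P/andP[h0 h1] /andP[Mx xMp]] := collapseP Ix.
have right_side : \forall t \near x, I01 t -> h t < h x + e.
  (* The second argument keeps [y] below 1, where [mass_le_strict] applies. *)
  pose y := Num.min (h x + e / 2) ((h x + 1) / 2).
  have hy : h x < y by rewrite lt_min; lra.
  have ye : y < h x + e by rewrite gt_min; lra.
  have y1 : y < 1 by rewrite gt_min; lra.
  have xy : x < M y by apply: le_lt_trans xMp (mass_le_strict h0 hy (ltW y1)).
  near=> t => It; apply: le_lt_trans ye; rewrite leNgt; apply/negP => yt.
  have [/I01P/andP[_ t1] /andP[Mt _]] := collapseP It.
  have : t < M y by near: t; exact: lt_nbhsl.
  by have := mass_lt_mono (ltW yt); lra.
have left_side : \forall t \near x, I01 t -> h x - e < h t.
  have [he|he] := leP e (h x); last first.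
    by near=> t => /collapseP[/I01P/andP[? _] _]; lra.
  pose y := h x - e / 2.
  have y0 : 0 <= y by rewrite /y; lra.
  have hy : y < h x by rewrite /y; lra.
  have xy : Mp y < x by apply: lt_le_trans (mass_le_strict y0 hy (ltW h1)) Mx.
  near=> t => It; apply: (@lt_le_trans _ _ y); first by rewrite /y; lra.
  rewrite leNgt; apply/negP => yt.
  have [/I01P/andP[t0 t1] /andP[_ Mt]] := collapseP It.
  have : Mp y < t by near: t; exact: lt_nbhsr.
  by have := mass_le_strict t0 yt (ltW (lt_trans hy h1)); have := mass_lt_le y; lra.
rewrite near_withinE; near=> t => It.
rewrite ltr_distlC; apply/andP; split.
  by move: It; near: t.
by move: It; near: t.
Unshelve. all: by end_near.
Qed.

(* The infimum of T(P_i) may or may not belong to T(P_i); if it does, adding its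
   atom makes [shifted_mass i] scale by 1/2 under T on the whole of P_i. *)
Definition shifted_mass i z : R := M z + (d i == z)%:R / (2 * n%:R).
Local Notation E := shifted_mass.

Let nR_gt0 : (0 : R) < n%:R. Proof. by rewrite ltr0n. Qed.

(** Apply [mass_preimage] to [[T x, T y[]: the only [d j] that can lie there is [d i], and only at
    [T x]. The extra term in [E] cancels exactly that hit. *)
Lemma shifted_mass_increment i x y : P i x -> P i y -> T x < T y ->
  E i (T y) - E i (T x) = mu [set t | T x <= T t < T y] / 2.
Proof.
move=> Px Py xy; rewrite /E (mass_lt_co (ltW xy)).
have dy : (d i == T y) = false.
  by apply/negbTE; rewrite neq_lt (le_lt_trans (image_inf_le Tbij Px) xy).
rewrite dy mul0r addr0 (mass_preimage T d n_gt0 [set t | T x <= t < T y]).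
rewrite -/(mu _); set m := mass _ _ _.
have -> : hits d [set t | T x <= t < T y] = (d i == T x)%:R / n%:R.
  rewrite /hits mulrC (bigD1 i)//= big1 ?addr0 => [|j ji].
    congr (_ / _); rewrite indicE; congr (nat_of_bool _)%:R.
    apply/idP/idP; rewrite inE/=; last by move/eqP ->; rewrite lexx.
    by move=> /andP[dx _]; rewrite eq_le dx (image_inf_le Tbij).
  (* Another [d j] in this interval would bring values of [T] on [P j] into [T(P i)], against
     injectivity. *)
  rewrite indicE memNset//= => /andP[xd dy'].
  have [w Pw wy] := image_inf_lt Tbij dy'.
  have xw : T x <= T w <= T y.
    by rewrite (le_trans xd (image_inf_le Tbij Pw)) ltW.
  have [z Pz zw] := image_cell_itv s1 Tb Px Py xw.
  have zwE : z = w := bij_inj Tbij (cell_I01 Pz) (cell_I01 Pw) zw.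
  by rewrite zwE in Pz; rewrite (cell_inj Pw Pz) eqxx in ji.
rewrite /m /=; set c := _%:R; have : n%:R != 0 :> R by rewrite gt_eqF.
by move=> n0; rewrite invfM; set q := mass _ _ _; set p := M _; set r := n%:R^-1; lra.
Qed.

Lemma shifted_mass_pos i x y : s i = 1 -> P i x -> P i y -> x < y ->
  E i (T y) - E i (T x) = (M y - M x) / 2.
Proof.
move=> si Px Py xy; have Txy : T x < T y by rewrite (Tb Px) (Tb Py) si; lra.
rewrite (shifted_mass_increment Px Py Txy) (mass_lt_co (ltW xy)) [M x + _]addrC addrK.
congr (_ / _); apply: eq_mass => // t It /=; split=> [tT|txy].
  have tT' : T x <= T t <= T y by lra.
  have [w Pw wt] := image_cell_itv s1 Tb Px Py tT'.
  have wtE : w = t := bij_inj Tbij (cell_I01 Pw) It wt.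
  by move: tT; rewrite wtE in Pw; rewrite (Tb Px) (Tb Py) (Tb Pw) si; lra.
have txy' : x <= t <= y by lra.
by rewrite (Tb Px) (Tb Py) (Tb (cell_itv Px Py txy')) si; lra.
Qed.

(** Reversing the orientation turns [[T y, T x[] into []x, y]], whence [Mp] instead of [M]. *)
Lemma shifted_mass_neg i x y : s i = -1 -> P i x -> P i y -> x < y ->
  E i (T x) - E i (T y) = (Mp y - Mp x) / 2.
Proof.
move=> si Px Py xy; have Txy : T y < T x by rewrite (Tb Px) (Tb Py) si; lra.
rewrite (shifted_mass_increment Py Px Txy) (mass_le_oc (ltW xy)) [Mp x + _]addrC addrK.
congr (_ / _); apply: eq_mass => // t It /=; split=> [tT|txy].
  have tT' : T y <= T t <= T x by lra.
  have [w Pw wt] := image_cell_itv s1 Tb Py Px tT'.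
  have wtE : w = t := bij_inj Tbij (cell_I01 Pw) It wt.
  by move: tT; rewrite wtE in Pw; rewrite (Tb Px) (Tb Py) (Tb Pw) si; lra.
have txy' : x <= t <= y by lra.
by rewrite (Tb Px) (Tb Py) (Tb (cell_itv Px Py txy')) si; lra.
Qed.

(** The constant term of the lifted branch, read off at an arbitrary point of the piece;
    [offset_pos] and [offset_neg] show that the choice is immaterial. *)
Definition offset i : R := let w := xget 0 (P i) in
  if s i == 1 then E i (T w) - M w / 2 else E i (T w) + Mp w / 2.
Local Notation c := offset.

Lemma offset_pos i y : s i = 1 -> P i y -> E i (T y) = M y / 2 + c i.
Proof.
move=> si Py; rewrite /c si eqxx; set w := xget _ _.
have Pw : P i w by exact: xgetPex (ex_intro _ y Py).
have [yw|wy|->] := ltgtP y w.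
- by have := shifted_mass_pos si Py Pw yw; lra.
- by have := shifted_mass_pos si Pw Py wy; lra.
- by lra.
Qed.

Lemma offset_neg i y : s i = -1 -> P i y -> E i (T y) = - (Mp y / 2) + c i.
Proof.
move=> si Py; have -> : c i = E i (T (xget 0 (P i))) + Mp (xget 0 (P i)) / 2.
  by rewrite /c si ifF//; apply/negbTE; rewrite lt_eqF//; lra.
set w := xget _ _; have Pw : P i w by exact: xgetPex (ex_intro _ y Py).
have [yw|wy|->] := ltgtP y w.
- by have := shifted_mass_neg si Py Pw yw; lra.
- by have := shifted_mass_neg si Pw Py wy; lra.
- by lra.
Qed.

(** * The lifted map and its semiconjugacy to [T] *)

Definition contraction x : R :=
  let i := letter P (h x) in s i * 2^-1 * x + c i.
Local Notation f := contraction.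

(** The fiber of [y], of length [mu {y}], is sent to a segment of half that length. It fits in the
    fiber of [T y], whose atom is at least [mu {y} / 2] plus the part of [nu] that shifts [E]. *)
Lemma contraction_gap i x y : P i y -> M y <= x <= Mp y ->
  M (T y) <= s i * 2^-1 * x + c i <= Mp (T y).
Proof.
move=> Py xy.
have EM : M (T y) <= E i (T y).
  by rewrite /E lerDl divr_ge0// mulr_ge0// ltW.
have EMp : E i (T y) + mu [set y] / 2 <= Mp (T y).
  rewrite mass_le_lt /E -addrA lerD2l.
  rewrite [leRHS](mass_preimage T d n_gt0) -/(mu _).
  have -> : mu [set y] = mu (T @^-1` [set T y]).
    apply: eq_mass => // t It /=; split=> [->//|Tty].
    by have := bij_inj Tbij It (cell_I01 Py) Tty.
  (* Only an inequality: when [T y] is the largest value on [P i], another [d j] may equal it. *)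
  have hit : (d i == T y)%:R / n%:R <= hits d [set T y].
    rewrite /hits mulrC ler_pM2l ?invr_gt0// (bigD1 i)//= indicE ler_wpDr//.
      by apply: sumr_ge0 => j _; rewrite indicE.
    by rewrite ler_nat; case: eqP => // ->; rewrite mem_set.
  by rewrite invfM; lra.
have := mass_le_lt y.
have [si|si] := s1 i.
  by have := offset_pos si Py; rewrite si; lra.
by have := offset_neg si Py; rewrite si; lra.
Qed.

Lemma contraction_semiconj x : I01 x -> I01 (f x) /\ h (f x) = T (h x).
Proof.
move=> Ix; have [Ih hx] := collapseP Ix.
have := contraction_gap (cell_letter P Ih) hx; rewrite -/(f x) => fx.
have IT := bij_I01 Tbij Ih.
have If : I01 (f x).
  have := mass_le_lt1 IT.
  have := mass_lt_mono (proj1 (andP (proj1 (I01P _) IT))); rewrite mass_lt0.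
  by move=> ? ?; apply/I01P; lra.
by split=> //; exact: collapse_unique.
Qed.

(** Equal images force [h x = h y] since [T] is injective, so both points use the same branch, of
    slope 1/2 or -1/2. *)
Lemma contraction_inj : set_inj I01 f.
Proof.
move=> x y; rewrite !inE => Ix Iy fxy.
have [_ hfx] := contraction_semiconj Ix; have [_ hfy] := contraction_semiconj Iy.
have hxy : h x = h y.
  apply: (bij_inj Tbij); [exact: (collapseP Ix).1|exact: (collapseP Iy).1|].
  by rewrite -hfx -hfy fxy.
move: fxy; rewrite /f hxy => /addIr; apply: mulfI.
rewrite mulf_neq0 ?invr_eq0 ?pnatr_eq0//.
by case: (s1 (letter P (h y))) => ->; rewrite ?oppr_eq0 oner_eq0.
Qed.

(** * The partition pulled back by [h] *)

Definition pulled_cell i : set R := [set x | I01 x /\ P i (h x)].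

Lemma pulled_cell_itv i : is_interval (pulled_cell i).
Proof.
move=> x y [Ix Px] [Iy Py] z xzy.
have Iz : I01 z by move: Ix Iy => /I01P ? /I01P ?; apply/I01P; lra.
split=> //; apply: (cell_itv Px Py).
by rewrite !collapse_mono ?inE//; lra.
Qed.

Lemma pulled_cell_nondeg i : exists x y, [/\ pulled_cell i x, pulled_cell i y & x < y].
Proof.
have [x [y [Px Py xy]]] := cell_nondeg P i.
have [Ix hx] := collapse_surj (cell_I01 Px).
have [Iy hy] := collapse_surj (cell_I01 Py).
exists (M x), (M y); split; [by split; rewrite ?hx|by split; rewrite ?hy|].
rewrite ltNge; apply/negP => yx.
have /(collapse_mono _ _)/wrap[] := yx; rewrite ?inE// hx hy.
by rewrite leNgt xy.
Qed.

Lemma pulled_cell_cover : \bigcup_i pulled_cell i = I01.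
Proof.
apply/seteqP; split=> [x [i _ []//]|x Ix].
by exists (letter P (h x)) => //; split=> //; exact/cell_letter/(collapseP Ix).1.
Qed.

Lemma pulled_cell_lt i j : (i < j)%N ->
  forall x y, pulled_cell i x -> pulled_cell j y -> x < y.
Proof.
move=> ij x y [Ix Px] [Iy Py]; rewrite ltNge; apply/negP => yx.
have := collapse_mono _ _ yx; rewrite !inE => /(_ Iy Ix).
by rewrite leNgt (cell_lt ij Px Py).
Qed.

Definition pulled_partition : interval_partition R n :=
  IntervalPartition pulled_cell_itv pulled_cell_nondeg pulled_cell_cover pulled_cell_lt.

Lemma contraction_model : half_contraction_model P T pulled_partition f h.
Proof.
split.
- split; last exact: contraction_inj.
  split; first by lra.
    by move=> x /contraction_semiconj[].
  exists c, s; split=> // i x /= [Ix Px].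
  by rewrite /f; have /letterP[_ ->] := Px.
- exact: collapse_continuous.
- split=> [x /collapseP[]//|y Iy].
  by have [IM hM] := collapse_surj Iy; exists (M y).
- exact: collapse_mono.
- move=> x Ix; apply/funext => k; rewrite /coding.
  have [Ifk hfk] : I01 (iter k f x) /\ h (iter k f x) = iter k T (h x).
    elim: k => [//|k [Ik hk]]; rewrite !iterS.
    by have [I' ->] := contraction_semiconj Ik; rewrite hk.
  have : pulled_cell (letter P (iter k T (h x))) (iter k f x).
    split=> //; rewrite hfk; apply: cell_letter.
    by rewrite -hfk; exact: (collapseP Ifk).1.
  by move=> /(letterP pulled_partition)[_ ->].
Qed.

End BlowUp.

Section Transitive.
Context {R : realType} {n : nat}.

Lemma transitive_model (P : interval_partition R n) (T : R -> R) :
  iet P T -> topologically_transitive T ->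
  exists (Q : interval_partition R n) (f h : R -> R), half_contraction_model P T Q f h.
Proof.
move=> [Tbij [b [s [s1 Tb]]]] [x0 [Ix0 /closure_dense_orbit dx0]].
have {}Tb i x : P i x -> T x = s i * x + b i by move/Tb; rewrite mulr1.
have dd := image_inf_orbits_dense Tbij s1 Tb Ix0 dx0.
by exists (pulled_partition Tbij dd), (contraction P T s), (collapse P T);
  exact: (contraction_model Tbij s1 Tb dd).
Qed.

End Transitive.

(** * Minimality of standard exchanges *)

Section GapOrbit.
Context {R : realType}.

(** Pigeonhole over [N] bins of length [1 / N < e]. *)
Lemma close_pair (l : nat -> R) e : (forall k, 0 <= l k < 1) -> 0 < e ->
  exists k k', (k < k')%N /\ `|l k - l k'| < e.
Proof.
move=> l01 e0; pose N := (Num.truncn e^-1).+1.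
have N0 : (0 : R) < N%:R by rewrite ltr0n.
have eN : 1 < e * N%:R.
  by rewrite -ltr_pdivrMl// mulr1 truncnS_gt.
have lN k : 0 <= l k * N%:R by have /andP[? _] := l01 k; rewrite mulr_ge0// ltW.
have lt_N k : (Num.truncn (l k * N%:R) < N)%N.
  by rewrite truncn_lt_nat// gtr_pMl//; have /andP[] := l01 k.
pose phi (k : 'I_N.+1) : 'I_N := Ordinal (lt_N k).
have /injectivePn[k [k' kk' phik]] : ~~ injectiveb phi.
  by apply/negP => /injectiveP/leq_card; rewrite !card_ord ltnn.
have close : `|l k - l k'| < e.
  have := congr1 val phik => /= tE.
  have /andP[a1 a2] := truncn_itv (lN k); have /andP[b1 b2] := truncn_itv (lN k').
  rewrite tE in a1 a2; rewrite -natr1 in a2; rewrite -natr1 in b2.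
  rewrite -(ltr_pM2r N0) -[X in _ * X < _]ger0_norm ?(ltW N0)// -normrM.
  by apply: lt_trans eN; rewrite mulrBl ltr_norml; apply/andP; split; lra.
have [lt_kk'|lt_k'k|E] := ltngtP k k'.
- by exists k, k'.
- by exists k', k; rewrite distrC.
- by move: kk'; rewrite (val_inj E) eqxx.
Qed.

(* The points l k are left ends of components of W, and moving such a
   component from l k to l k.+1 can only shorten it by cutting it at one of the
   finitely many points c j. Each c j cuts at most one of these disjoint
   components, so their lengths are bounded below. *)
Lemma no_gap_orbit n (W : set R) (l : nat -> R) (c : 'I_n -> R) e0 :
  (forall k, 0 <= l k < 1) -> injective l -> (forall k, ~ W (l k)) -> 0 < e0 ->
  (forall y, l 0%N < y < l 0%N + e0 -> W y) ->
  (forall k e, (forall y, l k < y < l k + e -> W y) ->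
    (forall j, ~ (l k < c j < l k + e)) ->
    forall y, l k.+1 < y < l k.+1 + e -> W y) -> False.
Proof.
move=> l01 linj lW e00 W0 step.
(* Two ends cut by the same [c j] coincide, as the larger would otherwise lie in [W]; so one
   distance bounds all. If [c j] cuts nothing, the value 1 is a dummy. *)
have cut j : exists e, 0 < e /\ forall k, l k < c j ->
    (forall y, l k < y <= c j -> W y) -> e <= c j - l k.
  have [[k [kc kW]]|no] := pselect (exists k, l k < c j /\
      forall y, l k < y <= c j -> W y); last first.
    by exists 1; split=> // k kc kW; case: no; exists k.
  exists (c j - l k); split=> [|k' k'c k'W]; first by lra.
  have [lt_l|lt_l|->//] := ltgtP (l k) (l k').
    by case: (lW k'); apply: kW; lra.
  by case: (lW k); apply: k'W; lra.
have [ce ceP] := choice cut.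
pose e := \big[Num.min/e0]_j ce j.
have e_gt0 : 0 < e by apply: lt_bigmin => // j _; have [] := ceP j.
have e_le0 : e <= e0 by exact: bigmin_le_id.
have e_le j : e <= ce j by exact: bigmin_le_cond.
have We k y : l k < y < l k + e -> W y.
  elim: k y => [|k IH] y; first by move=> ly; apply: W0; lra.
  apply: (step k e IH) => j jl.
  have [_ /(_ k)] := ceP j; have := e_le j.
  move=> e1 /(_ _ _)/wrap[||]; [lra| |lra].
  by move=> t tc; apply: IH; lra.
have [k [k' [kk' close]]] := close_pair l01 e_gt0.
(* Of two ends closer than [e], the larger lies in the gap after the smaller, hence in [W]. *)
have [lt_l|lt_l|E] := ltgtP (l k) (l k').
- apply: (lW k'); apply: (We k); rewrite ltr_distlC in close; lra.
- apply: (lW k); apply: (We k'); rewrite ltr_distlC in close; lra.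
- by rewrite (linj _ _ E) ltnn in kk'.
Qed.

End GapOrbit.

(** * Standard exchanges as local translations along orbits *)

Section Keane.
Context {R : realType} {n : nat}.
Variables (P : interval_partition R n) (T : R -> R) (b : 'I_n -> R).
Hypothesis Tbij : set_bij I01 I01 T.
Hypothesis Pco : forall i, exists u v : R, P i = `[u, v[%classic.
Hypothesis Tb : forall i x, P i x -> T x = x + b i.
Implicit Types (x y z : R) (i j : 'I_n).

Local Notation e := (left_endpoint P).
Local Notation r i := (sup (P i)).

Lemma cellP i x : P i x <-> e i <= x < r i.
Proof.
have [u [v Puv]] := Pco i.
have [y [_ [Py _ _]]] := cell_nondeg P i.
have uv : u < v by move: Py; rewrite Puv/= in_itv/=; lra.
have -> : e i = u by rewrite /left_endpoint Puv inf_itv//; rewrite bnd_simp.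
have -> : r i = v by rewrite Puv sup_itv//; rewrite bnd_simp.
by rewrite Puv/= in_itv.
Qed.

Lemma left_endpoint_cell i : P i (e i).
Proof.
by have [y [_ [/cellP Py _ _]]] := cell_nondeg P i; apply/cellP; lra.
Qed.

Let TI x : I01 x -> I01 (T x). Proof. exact: bij_I01. Qed.

Let iter_bij_I01 m x : I01 x -> I01 (iter m T x).
Proof. by apply: iter_I01; exact: TI. Qed.

Lemma iter_bij_inj m x y : I01 x -> I01 y -> iter m T x = iter m T y -> x = y.
Proof.
move=> Ix Iy; elim: m => [//|m IH] /= E; apply: IH.
by apply: (bij_inj Tbij) => //; exact: iter_bij_I01.
Qed.

(** Pieces are left-closed and right-open, so each point has a right neighborhood that visits the
    same pieces for [m] steps. *)
Lemma iter_right_germ m z : I01 z -> exists eta c : R, 0 < eta /\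
  forall y, z <= y < z + eta -> iter m T y = y + c /\
    forall k, (k < m)%N -> P (letter P (iter k T z)) (iter k T y).
Proof.
move=> Iz; elim: m => [|m [eta [c [eta0 germ]]]].
  by exists 1, 0; split=> // y _; rewrite addr0; split.
set w := iter m T z; have Pw : P (letter P w) w.
  exact/cell_letter/iter_bij_I01.
have /cellP w_r := Pw.
exists (Num.min eta (r (letter P w) - w)), (c + b (letter P w)).
split=> [|y]; first by rewrite lt_min; lra.
rewrite -ltrBlDl lt_min => zy.
have [|Ty Py] := germ y; first by lra.
have wE : w = z + c by have [|Tz _] := germ z; [lra|exact: Tz].
have Pwy : P (letter P w) (iter m T y) by apply/cellP; rewrite Ty; lra.
split=> [|k]; first by rewrite iterS (Tb Pwy) Ty; lra.
by rewrite ltnS leq_eqVlt => /orP[/eqP ->|/Py].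
Qed.

(** A two-sided neighborhood needs the orbit to stay off every left end, including 0. *)
Lemma iter_germ m z : I01 z -> (forall k i, (k < m)%N -> iter k T z <> e i) ->
  exists eta c : R, 0 < eta /\ forall y, `|y - z| < eta -> iter m T y = y + c /\
    forall k, (k < m)%N -> I01 (iter k T y).
Proof.
move=> Iz; elim: m => [|m IH] ze.
  by exists 1, 0; split=> // y _; rewrite addr0; split.
have [k i km|eta [c [eta0 germ]]] := IH; first exact/ze/ltnW.
set w := iter m T z; have Pw : P (letter P w) w.
  exact/cell_letter/iter_bij_I01.
have /cellP/andP[ew wr] := Pw.
have {}ew : e (letter P w) < w.
  by rewrite lt_neqAle ew andbT; apply/eqP => E; exact: (ze m _ (ltnSn m) (esym E)).
exists (Num.min eta (Num.min (w - e (letter P w)) (r (letter P w) - w))),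
  (c + b (letter P w)).
split=> [|y]; first by rewrite !lt_min; lra.
rewrite !lt_min !ltr_distlC => /and3P[zy1 zy2 zy3].
have [|Ty Iy] := germ y; first by rewrite ltr_distlC.
have wE : w = z + c.
  by have [|Tz _] := germ z; [rewrite subrr normr0|exact: Tz].
have Pwy : P (letter P w) (iter m T y) by apply/cellP; rewrite Ty; lra.
split=> [|k]; first by rewrite iterS (Tb Pwy) Ty; lra.
by rewrite ltnS leq_eqVlt => /orP[/eqP ->|/Iy//]; exact: cell_I01 Pwy.
Qed.

Lemma left_endpoint_I01 i : I01 (e i).
Proof. exact: cell_I01 (left_endpoint_cell i). Qed.

Lemma left_endpoint0 i : i = 0%N :> nat -> e i = 0.
Proof.
move=> i0; have I0 : I01 (0 : R) by apply/I01P; rewrite lexx ltr01.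
have P0 := cell_letter P I0; set j := letter P 0 in P0.
have /I01P/andP[e0 _] := left_endpoint_I01 i.
have [ij|ij] := ltnP i j.
  by have := cell_lt ij (left_endpoint_cell i) P0; lra.
have ji : j = i by apply: val_inj => /=; lia.
by move: P0; rewrite ji => /cellP; lra.
Qed.

(** * Consequences of irreducibility and the i.d.o.c *)

Hypothesis Tirr : irreducible T.
Hypothesis Tidoc : idoc P T.

(** As [T] translates each piece, 0 can only be the image of a left end. The end 0 itself is
    excluded, since [T] would be the identity on the first piece. *)
Lemma zero_image : exists2 j : 'I_n, (0 < j)%N & T (e j) = 0.
Proof.
have I0 : I01 (0 : R) by apply/I01P; rewrite lexx ltr01.
have [y Iy Ty] := bij_surj Tbij I0.
have Py := cell_letter P Iy; set j := letter P y in Py.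
have ey : e j = y.
  have /I01P/andP[Te0 _] := TI (left_endpoint_I01 j).
  move: Te0 Ty; rewrite (Tb (left_endpoint_cell j)) (Tb Py).
  by move/cellP : Py; lra.
exists j; last by rewrite ey.
rewrite lt0n; apply/eqP => j0; have y0 : y = 0 by rewrite -ey left_endpoint0.
have bj : b j = 0 by have := Tb Py; rewrite Ty y0; lra.
have /cellP := Py; rewrite ey y0 => r0.
(* The bound 1/2 keeps [delta] below 1 even when the piece is all of [I]. *)
apply: Tirr; exists (Num.min (r j) 2^-1).
split; first by rewrite lt_min gt_min; lra.
move=> _ [x /= + <-]; rewrite in_itv/= lt_min => /and3P[x0 xr x2].
rewrite in_itv/= lt_min.
have Px : P j x by apply/cellP; rewrite ey y0; lra.
by rewrite (Tb Px) bj; lra.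
Qed.

Lemma left_endpoint_aperiodic i m : (0 < m)%N -> iter m T (e i) <> e i.
Proof.
(* The i.d.o.c. speaks of interior ends; 0 is the image of one of them, which inherits its
   period. *)
move=> m0; wlog i0 : i / (0 < i)%N => [H|].
  have [|i0] := posnP i; last exact: H.
  move=> /left_endpoint0 -> T0; have [j j0 Tj] := zero_image.
  apply: (H j j0); apply: (bij_inj Tbij).
  - exact/iter_bij_I01/left_endpoint_I01.
  - exact: left_endpoint_I01.
  - by rewrite -iterS iterSr Tj T0.
move=> Ti; have [+ _] := Tidoc; move=> /(_ i i0); apply.
apply: (@sub_finite_set _ _ [set` [seq iter k T (e i) | k <- iota 0 m]]); last first.
  exact: finite_seq.
move=> _ [k _ <-] /=; elim/ltn_ind: k => k IH; have [km|mk] := ltnP k m.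
  by apply: (map_f (fun k => iter k T (e i))); rewrite mem_iota.
by rewrite -(subnK mk) iterD Ti; apply: IH; lia.
Qed.

(** For [j > 0] this is the i.d.o.c.; for the end 0, prolong its orbit back to the interior end that
    [T] sends to 0. *)
Lemma left_endpoint_orbits i j k : (0 < i)%N -> iter k.+1 T (e j) <> e i.
Proof.
move=> i0; wlog j0 : j k / (0 < j)%N => [H|].
  have [|j0] := posnP j; last exact: H.
  move=> /left_endpoint0 ->; have [j' j'0 <-] := zero_image.
  by rewrite -iterSr; exact: H.
have [->|/eqP ij] := eqVneq j i; first exact: left_endpoint_aperiodic.
move=> E; have [_ /(_ i j i0 j0)] := Tidoc.
rewrite eq_sym; move/eqP in ij; rewrite ij => /(_ isT)/seteqP[+ _].
by move=> /(_ (e i)); apply; split; [exists 0%N|exists k.+1].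
Qed.

(** Let [a] be the infimum of the points from which [T^m] is the identity up to [z]. Right germs
    give [T^m a = a]. If the orbit of [a] meets a left end, that end is periodic; if not, a
    two-sided germ continues the identity to the left of [a]. *)
Lemma aperiodic z m : I01 z -> (0 < m)%N -> iter m T z <> z.
Proof.
move=> Iz m0 Tz; have /I01P/andP[z0 z1] := Iz.
pose A : set R := [set u | 0 <= u <= z /\
  forall y, u <= y <= z -> iter m T y = y].
have Az : A z by split=> [|y yz]; [lra|rewrite (_ : y = z)//; lra].
have infA : has_inf A by split; [exists z|exists 0 => u [/andP[]]].
set a := inf A; have az : a <= z by exact: (ge_inf infA.2).
have a0 : 0 <= a by apply: lb_le_inf; [exists z|move=> u [/andP[]]].
have Ia : I01 a by apply/I01P; lra.
have fixA y : a < y -> y <= z -> iter m T y = y.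
  move=> ay yz; have ya : 0 < y - a by lra.
  have [u [_ Au] uy] := inf_adherent ya infA.
  by apply: Au; rewrite -/a in uy; lra.
have Ta : iter m T a = a.
  have [eta [c [eta0 germ]]] := iter_right_germ m Ia.
  have [az'|az'] := ltP a z; last by rewrite (_ : a = z)//; lra.
  pose y := Num.min (a + eta / 2) z.
  have ay : a < y by rewrite lt_min; lra.
  have yz : y <= z by rewrite ge_min lexx orbT.
  have ye : y <= a + eta / 2 by rewrite ge_min lexx.
  have [|Ty _] := germ y; first by lra.
  have [|-> _] := germ a; first by lra.
  by have := fixA y ay yz; lra.
have [[k [i [km ki]]]|no] := pselect (exists k i, (k < m)%N /\ iter k T a = e i).
  by apply: (@left_endpoint_aperiodic i m m0); rewrite -ki -iterD addnC iterD Ta.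
have [k i km ki|eta [c [eta0 germ]]] := @iter_germ m a Ia.
  by apply: no; exists k, i.
have c0 : c = 0 by have [|+ _] := germ a; rewrite ?subrr ?normr0// Ta; lra.
pose u := a - eta / 2.
have [|_ /(_ 0%N m0)/= /I01P Iu] := germ u; first by rewrite ltr_distlC /u; lra.
have : A u.
  split; first by rewrite /u in Iu *; lra.
  move=> y uy; have [ay|ya] := ltP a y; first by apply: fixA; lra.
  have [|-> _] := germ y; first by rewrite ltr_distlC; rewrite /u in uy; lra.
  by rewrite c0 addr0.
by move=> /(ge_inf infA.2); rewrite -/a /u; lra.
Qed.

Lemma forward_gap l eps : I01 l -> (forall y, l < y < l + eps -> I01 y) ->
  (forall j, ~ (l < e j < l + eps)) ->
  forall y, l < y < l + eps -> T y = y + (T l - l).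
Proof.
move=> Il gapI gap y ly; have Pl := cell_letter P Il.
have Py := cell_letter P (gapI y ly); set i := letter P l in Pl.
set j := letter P y in Py; suff E : j = i.
  by rewrite E in Py; rewrite (Tb Py) (Tb Pl); lra.
have /cellP ey := Py.
have [ij|ji|/val_inj//] := ltngtP i j.
  by case: (gap j); have := cell_lt ij Pl (left_endpoint_cell j); lra.
by exfalso; have := cell_lt ji Py Pl; lra.
Qed.

(** The inverse of [T] breaks only at the points [T (e j)]. If the gap passed the right end of
    [P i], the end [w] of the translated piece would have a preimage interior to its piece, and
    points just below [w] would have two preimages. *)
Lemma backward_gap y0 eps : I01 y0 -> (forall t, T y0 < t < T y0 + eps -> I01 t) ->
  (forall j, ~ (T y0 < T (e j) < T y0 + eps)) ->
  forall z, y0 < z < y0 + eps -> I01 z /\ T z = z + (T y0 - y0).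
Proof.
move=> Iy0 gapI gap z y0z; have Py0 := cell_letter P Iy0.
set i := letter P y0 in Py0; have /cellP ey0 := Py0; have Ty0 := Tb Py0.
have [zr|rz] := ltP z (r i).
  have Pz : P i z by apply/cellP; lra.
  by split; [exact: cell_I01 Pz|rewrite (Tb Pz) Ty0; lra].
exfalso; pose w := T y0 + (r i - y0).
have Iw : I01 w by apply: gapI; rewrite /w; lra.
have [y2 Iy2 Ty2] := bij_surj Tbij Iw.
have Py2 := cell_letter P Iy2; set j := letter P y2 in Py2.
have /cellP/andP[ey2 y2r] := Py2.
move: ey2; rewrite le_eqVlt => /orP[/eqP ey2|ey2].
  by apply: (gap j); rewrite ey2 Ty2 /w; lra.
pose del := Num.min (y2 - e j) (r i - y0).
have del0 : 0 < del by rewrite lt_min; lra.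
have del1 : del <= y2 - e j by rewrite ge_min lexx.
have del2 : del <= r i - y0 by rewrite ge_min lexx orbT.
have Pa : P i (r i - del) by apply/cellP; lra.
have Pc : P j (y2 - del) by apply/cellP; lra.
have E : r i - del = y2 - del.
  apply: (bij_inj Tbij (cell_I01 Pa) (cell_I01 Pc)).
  by move: Ty2; rewrite (Tb Pa) (Tb Pc) (Tb Py2) /w Ty0; lra.
have ij : j = i by rewrite E in Pa; exact: cell_inj Pc Pa.
by rewrite ij in y2r; lra.
Qed.

(** * Points that a given orbit eventually avoids *)

Section Avoided.
Variable x : R.
Hypothesis Ix : I01 x.

(** The complement in [I] of the omega-limit set of [x]. *)
Definition eventually_avoided : set R := [set z | I01 z /\
  exists (eps : R) (N : nat), 0 < eps /\
    forall k, (N <= k)%N -> eps <= `|iter k T x - z|].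
Local Notation W := eventually_avoided.

Lemma avoided_image y : I01 y -> (forall i, y <> e i) -> W y <-> W (T y).
Proof.
move=> Iy ye.
have [k i|eta [c [eta0 germ]]] := @iter_germ 1 y Iy.
  by case: k => // _; exact: ye.
have {}germ z : `|z - y| < eta -> T z = z + c /\ I01 z.
  by move=> /germ[Tz /(_ 0%N isT)].
have [Ty _] : T y = y + c /\ I01 y by apply: germ; rewrite subrr normr0.
split=> -[_ [eps [N [eps0 av]]]].
  split; first exact: TI.
  exists (Num.min eps eta), N.+1; split=> [|k Nk]; first by rewrite lt_min eps0.
  rewrite leNgt; apply/negP; rewrite lt_min => /andP[k1 k2].
  case: k Nk k1 k2 => // k Nk; rewrite iterS => k1 k2.
  (* An orbit point near [T y] at time [k.+1] comes, by injectivity, from one near [y] at time [k];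
     hence [N.+1] above. *)
  have [|Tz Iz] := germ (T (iter k T x) - c).
    by rewrite (_ : _ - c - y = T (iter k T x) - T y)// Ty; lra.
  have kz : T (iter k T x) - c = iter k T x.
    by apply: (bij_inj Tbij Iz (iter_bij_I01 _ Ix)); rewrite Tz; lra.
  have := av k Nk; rewrite -kz leNgt => /negP; apply.
  by rewrite (_ : _ - c - y = T (iter k T x) - T y)// Ty; lra.
split=> //; exists (Num.min eps eta), N; split=> [|k Nk]; first by rewrite lt_min eps0.
rewrite leNgt; apply/negP; rewrite lt_min => /andP[k1 /germ[Tk _]].
have := av k.+1 (leqW Nk); rewrite iterS Tk Ty leNgt => /negP; apply.
by rewrite (_ : _ + c - _ = iter k T x - y)//; lra.
Qed.

Lemma avoided_open c : W c -> exists eps : R, 0 < eps /\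
  forall y, I01 y -> `|y - c| < eps -> W y.
Proof.
move=> [Ic [eps [N [eps0 av]]]]; exists (eps / 2); split=> [|y Iy yc]; first by lra.
split=> //; exists (eps / 2), N; split=> [|k /av kc]; first by lra.
rewrite leNgt; apply/negP => ky; have := ler_distD y (iter k T x) c.
by lra.
Qed.

(* Along the forward or the backward orbit of a left end of a component of W,
   the points are again such ends as long as no discontinuity is met; by the
   i.d.o.c. one of the two directions never meets any. *)
Lemma avoided_no_left_end l eps : I01 l -> 0 < l -> ~ W l -> 0 < eps ->
  (forall y, l < y < l + eps -> W y) -> False.
Proof.
move=> Il l0 nWl eps0 Wl.
have WI y : W y -> I01 y by case.
have [[k0 [i ki]]|no] := pselect (exists k i, iter k T l = e i); last first.
  pose ls k := iter k T l.
  have Ils k : I01 (ls k) by exact: iter_bij_I01.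
  apply: (@no_gap_orbit _ _ W ls e eps) => //.
  - have inj k k' : (k < k')%N -> ls k <> ls k'.
      move=> kk' E; have kk'0 : (0 < k' - k)%N by rewrite subn_gt0.
      apply: (aperiodic Il kk'0); apply: (@iter_bij_inj k) => //.
        exact: iter_bij_I01.
      by rewrite -iterD subnKC ?(ltnW kk')// -/(ls k').
    by move=> k k' E; have [/inj|/inj|//] := ltngtP k k'; rewrite E.
  - elim=> [//|k IH]; rewrite /ls iterS => Wk; apply: IH.
    by apply/(avoided_image (Ils k)) => // i ki; apply: no; exists k, i.
  - move=> k d Wd gap y ly; rewrite /ls iterS in ly.
    have Td := forward_gap (Ils k) (fun y yl => WI _ (Wd y yl)) gap.
    have ly' : ls k < y - (T (ls k) - ls k) < ls k + d by rewrite /ls; lra.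
    have Wy := Wd _ ly'; rewrite -[y](subrK (T (ls k) - ls k)) -(Td _ ly').
    apply/(avoided_image (WI _ Wy)) => // i ie.
    by apply: (gap i); rewrite -ie.
(* The forward orbit of [l] meets [e i], so an [e j] behind [l] would be joined to it. If [e i = 0],
   then [l > 0] allows one step back, to the interior end sent to 0. *)
have back k' j : iter k'.+1 T (e j) <> l.
  move=> E; have [i0|i0] := posnP i.
    case: k0 ki => [|k0].
      by rewrite (left_endpoint0 i0) => /= l0'; rewrite l0' ltxx in l0.
    rewrite iterS (left_endpoint0 i0); have [j' j'0 Tj'] := zero_image.
    rewrite -Tj' => /(bij_inj Tbij (iter_bij_I01 _ Il) (left_endpoint_I01 _)).
    by rewrite -E -iterD addnS; exact: left_endpoint_orbits.
  by move: ki; rewrite -E -iterD addnS; exact: left_endpoint_orbits.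
have /choice[g gP] : forall y, exists z, I01 y -> I01 z /\ T z = y.
  move=> y; have [Iy|nIy] := pselect (I01 y); last by exists y.
  by have [z Iz Tz] := bij_surj Tbij Iy; exists z.
pose ls k := iter k g l.
have Ils k : I01 (ls k) by elim: k => [//|k /gP[]].
have Tls k : T (ls k.+1) = ls k by have [] := gP _ (Ils k).
have iterTls k : iter k T (ls k) = l by elim: k => // k; rewrite iterSr Tls.
have nls k j : ls k <> T (e j).
  by move=> E; apply: (back k j); rewrite iterSr -E.
(* Backwards, gaps are cut at the points [T (e j)], where the inverse of [T] breaks. *)
apply: (@no_gap_orbit _ _ W ls (T \o e) eps) => //.
- have inj k k' : (k < k')%N -> ls k <> ls k'.
    move=> kk' E; have kk'0 : (0 < k' - k)%N by rewrite subn_gt0.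
    apply: (aperiodic Il kk'0); rewrite -[in LHS](iterTls k) -iterD.
    by rewrite subnK ?(ltnW kk')// E.
  by move=> k k' E; have [/inj|/inj|//] := ltngtP k k'; rewrite E.
- elim=> [//|k IH] Wk; apply: IH; rewrite -Tls.
  apply/(avoided_image (Ils k.+1)) => // j E.
  by apply: (nls k j); rewrite -Tls E.
- move=> k d Wd gap y ly; rewrite -Tls in Wd gap.
  have [Iy Ty] := backward_gap (Ils _) (fun y yl => WI _ (Wd y yl)) gap ly.
  have Tgap : T (ls k.+1) < T y < T (ls k.+1) + d by rewrite Ty; lra.
  apply/(avoided_image Iy); last exact: Wd.
  by move=> j E; apply: (gap j); rewrite /= -E.
Qed.

(** Otherwise the last point of []0, c]] outside [W], which exists as [W] is relatively open, is a
    left end excluded by [avoided_no_left_end]. *)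
Lemma avoided_initial c y : W c -> 0 < y -> y <= c -> W y.
Proof.
move=> Wc y0 yc; apply: contrapT => nWy.
have [/I01P c01 _] := Wc.
pose A : set R := [set t | 0 < t <= c /\ ~ W t].
have Ay : A y by split=> //; rewrite y0.
have supA : has_sup A by split; [exists y|exists c => t [/andP[]]].
set l := sup A; have yl : y <= l by exact: (ub_le_sup supA.2).
have lc : l <= c by apply: ge_sup; [exists y|move=> t [/andP[]]].
have Il : I01 l by apply/I01P; lra.
have Wlc t : l < t -> t <= c -> W t.
  move=> lt tc; apply: contrapT => nWt.
  have : A t by split=> //; lra.
  by move=> /(ub_le_sup supA.2); rewrite -/l; lra.
have nWl : ~ W l.
  move=> /avoided_open[eps [eps0 near_l]].
  have [t At lt] := sup_adherent eps0 supA; rewrite -/l in lt.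
  have tl : t <= l by exact: (ub_le_sup supA.2).
  case: At => tc nWt; apply: nWt; apply: near_l.
    by apply/I01P; lra.
  by rewrite distrC ger0_norm; lra.
have {}lc : l < c.
  by rewrite lt_neqAle lc andbT; apply/eqP => lc'; apply: nWl; rewrite lc'.
apply: (@avoided_no_left_end l (c - l)) => //; [by lra|by lra|].
by move=> t lt; apply: Wlc; lra.
Qed.

(** Otherwise the orbit accumulates only at 0 and 1. Let [z = sup A] be its upper limit. If [z = 0],
    the orbit also accumulates at [T 0 > 0]; if [z = 1], at [1 + b i] in []0, 1[], with [i] the last
    piece. Both are impossible. *)
Lemma cluster_interior : exists2 z, 0 < z < 1 & ~ W z.
Proof.
apply: contrapT => no.
have {no} Wall z : 0 < z < 1 -> W z.
  by move=> z01; apply: contrapT => nWz; apply: no; exists z.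
have I01k k : 0 <= iter k T x < 1 by apply/I01P; exact: iter_bij_I01.
pose A : set R := [set y | forall N, exists2 k, (N <= k)%N & y <= iter k T x].
have A0 : A 0 by move=> N; exists N => //; have /andP[] := I01k N.
have supA : has_sup A.
  split; first by exists 0.
  exists 1 => y /(_ 0%N)[k _ yk]; have /andP[_ k1] := I01k k; lra.
have visits eps N : 0 < eps -> exists2 k, (N <= k)%N &
    sup A - eps < iter k T x < sup A + eps.
  move=> eps0; have [y Ay yA] := sup_adherent eps0 supA.
  have : ~ A (sup A + eps / 2) by move=> /(ub_le_sup supA.2); lra.
  move=> /existsNP[N' nA].
  have [k Nk yk] := Ay (maxn N N'); exists k; first by lia.
  have : ~ (sup A + eps / 2 <= iter k T x) by move=> ?; apply: nA; exists k => //; lia.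
  by move=> /negP; rewrite -ltNge; lra.
set z := sup A in visits.
have z0 : 0 <= z by exact: (ub_le_sup supA.2).
have z1 : z <= 1.
  apply: ge_sup; first by exists 0.
  by move=> y /(_ 0%N)[k _ yk]; have /andP[_ k1] := I01k k; lra.
have [zE|zn0] := eqVneq z 0.
  have I0 : I01 (0 : R) by apply/I01P; rewrite lexx ltr01.
  have [eta [c [eta0 germ]]] := iter_right_germ 1 I0.
  have T0 : T 0 = c by have [|/= -> _] := germ 0; lra.
  have /I01P Tc := TI I0; have c0 : c != 0.
    by apply/eqP => c0; apply: (@aperiodic 0 1 I0) => //=; rewrite T0.
  have [_ [eps [N [eps0 av]]]] : W c.
    by apply: Wall; move: Tc; rewrite T0; lra.
  have ee0 : 0 < Num.min eps eta by rewrite lt_min eps0.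
  have [k Nk] := visits _ N ee0; rewrite zE !add0r lt_min => kz.
  have := I01k k => k0; have [|/= Tk _] := germ (iter k T x); first by lra.
  have := av k.+1 (leqW Nk); rewrite iterS Tk addrK ger0_norm; lra.
have [zE|zn1] := eqVneq z 1; last first.
  have [_ [eps [N [eps0 av]]]] : W z by apply: Wall; lra.
  have [k Nk kz] := visits _ N eps0.
  by have := av k Nk; rewrite leNgt ltr_distlC => /negP; apply; lra.
have last_cell i : (exists y, P i y) -> (forall j, (j <= i)%N) -> r i = 1.
  move=> [y0 /cellP Py0] imax; apply/eqP; rewrite eq_le; apply/andP; split.
    by apply: ge_sup; [exists y0; apply/cellP|move=> y /cell_I01/I01P/andP[_ /ltW]].
  rewrite leNgt; apply/negP => r1.
  have /I01P y0I := cell_I01 (proj2 (cellP i y0) Py0).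
  have Ir : I01 (r i) by apply/I01P; lra.
  have Pr := cell_letter P Ir; have := imax (letter P (r i)).
  rewrite leq_eqVlt => /orP[/eqP/val_inj E|lti].
    by rewrite E in Pr; move/cellP : Pr; lra.
  by have := cell_lt lti Pr (proj2 (cellP i y0) Py0); lra.
have n_gt0 := interval_partition_gt0 P.
have n1 : (n.-1 < n)%N by rewrite prednK.
pose i : 'I_n := Ordinal n1.
have ri : r i = 1.
  apply: last_cell; first by exists (e i); exact: left_endpoint_cell.
  by move=> j; rewrite /= -ltnS prednK.
have /I01P ei := left_endpoint_I01 i.
have Pi y : e i <= y < 1 -> P i y by move=> ey; apply/cellP; rewrite ri.
have Ti y : e i <= y < 1 -> T y = y + b i by move=> /Pi/Tb.
have b_le0 : b i <= 0.
  rewrite leNgt; apply/negP => b0; pose y := Num.max (e i) (1 - b i).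
  have y1 : e i <= y < 1 by rewrite le_max lexx /= gt_max; lra.
  have yb : 1 - b i <= y by rewrite le_max lexx orbT.
  by have := TI (cell_I01 (Pi y y1)); rewrite (Ti y y1) => /I01P; lra.
have b_gt : - 1 < b i.
  pose y := (e i + 1) / 2; have y1 : e i <= y < 1 by rewrite /y; lra.
  by have := TI (cell_I01 (Pi y y1)); rewrite (Ti y y1) => /I01P; lra.
have eps1 : 0 < 1 - e i by lra.
have bn0 : b i != 0.
  apply/eqP => b0; have [k _ kz] := visits _ 0%N eps1.
  have Tk : T (iter k T x) = iter k T x.
    by have := I01k k => k0; rewrite Ti ?b0 ?addr0//; lra.
  exact: (@aperiodic _ 1 (iter_bij_I01 k Ix) isT).
have [_ [eps [N [eps0 av]]]] : W (1 + b i) by apply: Wall; lra.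
have ee0 : 0 < Num.min eps (1 - e i) by rewrite lt_min eps0.
have me : Num.min eps (1 - e i) <= eps by rewrite ge_min lexx.
have mi : Num.min eps (1 - e i) <= 1 - e i by rewrite ge_min lexx orbT.
have [k Nk] := visits _ N ee0; rewrite zE => kz.
have := I01k k => k0; have := av k.+1 (leqW Nk).
by rewrite iterS Ti; [rewrite ltr0_norm; lra|lra].
Qed.

Lemma dense_orbit_minimal : dense_orbit T x.
Proof.
move=> u v u0 uv v1; apply: contrapT => no.
have Wc : W ((u + v) / 2).
  split; first by apply/I01P; lra.
  exists ((v - u) / 2), 0%N; split=> [|k _]; first by lra.
  rewrite leNgt ltr_distlC; apply/negP => kc; apply: no; exists k; lra.
have [z z01 nWz] := cluster_interior.
have supW : has_sup W.
  by split; [exists ((u + v) / 2)|exists 1 => t [/I01P/andP[_ /ltW]]].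
have rz : sup W <= z.
  apply: ge_sup; first by exists ((u + v) / 2).
  move=> t Wt; rewrite leNgt; apply/negP => zt; apply: nWz.
  by apply: avoided_initial Wt _ _; lra.
have r0 : (u + v) / 2 <= sup W by exact: (ub_le_sup supW.2).
apply: Tirr; exists (sup W); split; first by lra.
move=> _ [t /= + <-]; rewrite in_itv/= => tr; rewrite in_itv/=.
have It : I01 t by apply/I01P; lra.
have /I01P/andP[-> _] := TI It; rewrite /= ltNge; apply/negP => rT.
have Pt := cell_letter P It; have /cellP et := Pt.
have tr0 : 0 < sup W - t by lra.
have [c Wc' tc] := sup_adherent tr0 supW.
(* As [W] is an initial segment, it contains this point [y] to the right of [t] in the same piece.
   Since [y] is no left end, [T y] belongs to [W], yet [T y > T t >= sup W]. *)
pose y := Num.min c ((t + r (letter P t)) / 2).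
have ty : t < y by rewrite lt_min; lra.
have yc : y <= c by rewrite ge_min lexx.
have yr : y < r (letter P t) by rewrite gt_min; lra.
have Py : P (letter P t) y by apply/cellP; lra.
have Wy : W y by apply: avoided_initial Wc' _ _; lra.
have WTy : W (T y).
  apply/(avoided_image (cell_I01 Py)) => // i ye.
  have Pei := left_endpoint_cell i; rewrite -ye in Pei.
  by have E := cell_inj Pei Py; rewrite E in ye; lra.
have : T y <= sup W by exact: (ub_le_sup supW.2).
by move: rT; rewrite (Tb Pt) (Tb Py); lra.
Qed.

End Avoided.

(** A word read from [z] is read from a whole right neighborhood of [z], which the orbit of [x]
    enters by density. *)
Lemma coding_language_sub x y : I01 x -> I01 y ->
  language (coding P T y) `<=` language (coding P T x).
Proof.
move=> Ix Iy _ [m [k ->]]; set z := iter m T y.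
have Iz : I01 z by exact: iter_bij_I01.
have [eta [c [eta0 germ]]] := iter_right_germ k Iz.
have /I01P/andP[z0 z1] := Iz.
have [|||m' xm'] := @dense_orbit_minimal x Ix z (Num.min (z + eta) 1).
- by [].
- by rewrite lt_min z1 ltrDl eta0.
- by rewrite ge_min lexx orbT.
exists m', k; rewrite -[m]addn0 -[m']addn0 !iotaDl -!map_comp.
apply/eq_in_map => j; rewrite mem_iota /= add0n => jk.
have [|_ /(_ j jk)/letterP[_]] := germ (iter m' T x).
  by move: xm'; rewrite lt_min; lra.
by rewrite /coding addnC iterD addnC iterD => ->.
Qed.

Lemma standard_transitive : topologically_transitive T.
Proof.
have I0 : I01 (0 : R) by apply/I01P; rewrite lexx ltr01.
by exists 0; split=> //; apply/closure_dense_orbit; exact: dense_orbit_minimal.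
Qed.

End Keane.

Theorem theorem2p2 (R : realType) (n : nat) (P : interval_partition R n)
    (T : R -> R) (hT : iet P T) :
  (topologically_transitive T ->
     exists (Q : interval_partition R n) (f h : R -> R),
       half_contraction_model P T Q f h) /\
  (standard P T -> irreducible T -> idoc P T ->
     exists (Q : interval_partition R n) (f h : R -> R),
       half_contraction_model P T Q f h /\
       exists L : set (seq 'I_n), has_language P T L /\ has_language Q f L).
Proof.
split=> [Ttr|[Pco [b Tb]] Tirr Tidoc]; first exact: transitive_model hT Ttr.
have [Tbij _] := hT.
have Ttr := standard_transitive Tbij Pco Tb Tirr Tidoc.
have [Q [f [h hQ]]] := transitive_model hT Ttr.
exists Q, f, h; split=> //; exists (language (coding P T 0)).
have I0 : I01 (0 : R) by apply/I01P; rewrite lexx ltr01.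
have PTL : has_language P T (language (coding P T 0)).
  by move=> x Ix; apply/seteqP; split;
    exact: (coding_language_sub Tbij Pco Tb Tirr Tidoc).
split=> // x Ix; have [_ _ [hI _] _ ->//] := hQ.
exact/PTL/hI.
Qed.
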